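(* Let $V$ be a real vector space of dimension $n$ with a scalar product $\langle\cdot,\cdot\rangle$, let $N\ge 1$ be an integer, and let $e_1,\dots,e_N\in V$ and $\alpha_1,\dots,\alpha_N\in V$ be two sequences of vectors. For each $i$ let $M_i:V\to V$ be the operator $M_i(v)=\langle\alpha_i,v\rangle e_i$. Let $$P(x_1,\dots,x_N)=\sum_{s=1}^{d}\ \sum_{1\le i_1,\dots,i_s\le N}p_{i_1,\dots,i_s}\,x_{i_1}\cdots x_{i_s}$$ be a noncommutative polynomial (with real coefficients, without constant term) of degree $d$, and let $M=P(M_1,\dots,M_N)$, where a monomial $x_{i_1}\cdots x_{i_s}$ is evaluated as the operator obtained by applying first $M_{i_1}$, then $M_{i_2}$, and so on, and last $M_{i_s}$. Then the characteristic polynomial of $M$ is $$\operatorname{char}_M(t)=\sum_{k=0}^{n}(-1)^k\mu_k\,t^{\,n-k},\qquad \mu_k=\sum_{G\in\mathcal{D}_{N,k}}W_P(G)\,\det\bigl(\langle\alpha_{d_1^-},e_{d_2^+}\rangle\bigr),$$ where $\mathcal{D}_{N,k}$ is the set of DOOMBs with vertices $1,2,\dots,N$ and $k$ edges, $d_1$ (row index) and $d_2$ (column index) run through the set of all edges of $G$, and $d^-$, $d^+$ are the initial and the terminal vertex of a directed edge $d$.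
   Context: $\operatorname{char}_M(t)=\det(t\cdot\mathrm{id}-M)$. For vertices $a,b\in\{1,\dots,N\}$ define the weight $$W_P(a,b)=\sum_{s=1}^{d}\ \sum_{i_1=a,\,i_2,\dots,i_{s-1},\,i_s=b}p_{i_1,\dots,i_s}\,\langle\alpha_{i_2},e_{i_1}\rangle\langle\alpha_{i_3},e_{i_2}\rangle\cdots\langle\alpha_{i_s},e_{i_{s-1}}\rangle,$$ where the inner sum is over all sequences $i_1,\dots,i_s\in\{1,\dots,N\}$ with $i_1=a$ and $i_s=b$ (for $s=1$ there is one term $p_a$ if $a=b$ and no term otherwise). For a directed graph $G$ with vertices $1,\dots,N$ put $W_P(G)=\prod_{(a,b)}W_P(a,b)$, the product over all directed edges $(a,b)$ of $G$. A directed graph $G$ with vertices $1,\dots,N$ is called a discrete oriented one-dimensional manifold with (possibly empty) boundary (DOOMB) if each of its connected components is either an oriented chain (distinct vertices $i_1,\dots,i_\ell$, $\ell\ge1$, and edges $(i_1,i_2),(i_2,i_3),\dots,(i_{\ell-1},i_\ell)$; an isolated vertex is allowed) or an oriented cycle (distinct vertices $i_1,\dots,i_{\ell-1}$, with $\ell\ge 2$, the same edges, and $i_\ell=i_1$; a loop at one vertex is allowed). Equivalently, every vertex has at most one outgoing and at most one incoming edge. For $k=0$ the product and determinant are empty and equal $1$. *)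

(* Defs.v *)
From HB Require Import structures.
From mathcomp Require Import all_boot all_order all_algebra.
From mathcomp Require Export sesquilinear reals finmap monalg.

Set Implicit Arguments.
Unset Strict Implicit.
Unset Printing Implicit Defensive.

Import GRing.Theory passmx.

Local Open Scope ring_scope.

(* An endomorphism is represented here by a matrix in a fixed basis; by
   [char_lfunE] the result does not depend on that basis. *)
Definition char_lfun (F : fieldType) (V : vectType F) (f : 'End(V)) : {poly F} :=
  char_poly (mxof (vbasis {:V}) (vbasis {:V}) f).

Lemma char_lfunE (F : fieldType) (V : vectType F) (f : 'End(V))
    (b : (\dim {:V}).-tuple V) : basis_of {:V} b ->
  char_lfun f = char_poly (mxof b b f).
Proof.
move=> bB; rewrite /char_lfun; set c := vbasis {:V}.
have cB : basis_of {:V} c := vbasisP _.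
set P := mxof b c \1%VF; set Q := mxof c b \1%VF.
have QP : Q *m P = 1%:M.
  by rewrite -(mxof_comp c c bB) comp_lfun1l mxof1 ?(basis_free cB).
have -> : mxof c c f = Q *m mxof b b f *m P.
  by rewrite -(mxof_comp c b bB) -(mxof_comp c c bB) comp_lfun1l comp_lfun1r.
rewrite /char_poly /char_poly_mx; set A := mxof b b f.
have -> : 'X%:M - map_mx polyC (Q *m A *m P) =
    map_mx polyC Q *m ('X%:M - map_mx polyC A) *m map_mx polyC P.
  rewrite mulmxBr mulmxBl scalar_mxC -(mulmxA _ (map_mx polyC Q) (map_mx polyC P)) -!map_mxM QP.
  by rewrite map_mx1 mulmx1.
rewrite !det_mulmx mulrC mulrA -det_mulmx -map_mxM.
by rewrite (mulmx1C QP) map_mx1 det1 mul1r.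
Qed.

Definition rank1_op (R : realType) (V : vectType R) (dot : {dot V for idfun})
    (a e : V) : 'End(V) := linfun (fun v => dot a v *: e).

Lemma rank1_opE (R : realType) (V : vectType R) (dot : {dot V for idfun})
    (a e v : V) : rank1_op dot a e v = dot a v *: e.
Proof.
have lin : linear (fun v => dot a v *: e).
  by move=> k u w; rewrite linearPr /= scalerDl scalerA.
pose mx := GRing.isSemilinear.Build _ _ _ _ _ (GRing.semilinear_linear lin).
pose g : {linear V -> V} := HB.pack (fun v => dot a v *: e) mx.
exact: (lfunE g).
Qed.

(* Operators act in the order in which they occur in the word [w], so the word
   i_1 ... i_s becomes the composite M_{i_s} \o ... \o M_{i_1}. *)
Definition word_op (F : fieldType) (V : vectType F) (N : nat)
    (M : 'I_N -> 'End(V)) (w : seq 'I_N) : 'End(V) :=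
  foldl (fun f i => (M i \o f)%VF) \1%VF w.

(* Noncommutative polynomials in x_1, ..., x_N are the elements of the free
   associative algebra {malg R[{fmonom 'I_N}]}: {fmonom 'I_N} is the monoid of
   words over 'I_N, and P@_(FMonom w) is the coefficient of the word w. *)
Definition nc_eval (R : realType) (V : vectType R) (N : nat)
    (P : {malg R[{fmonom 'I_N}]}) (M : 'I_N -> 'End(V)) : 'End(V) :=
  \sum_(m <- msupp P) P@_m *: word_op M (fmonom_val m).

(* All words w have size s >= 1, so the default values of head and last
   are never used; the product is over consecutive letters of w. *)
Definition edge_weight (R : realType) (V : vectType R) (dot : {dot V for idfun})
    (N d : nat) (e alpha : 'I_N -> V) (P : {malg R[{fmonom 'I_N}]})
    (a b : 'I_N) : R :=
  \sum_(1 <= s < d.+1)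
    \sum_(w : s.-tuple 'I_N | (head a w == a) && (last b w == b))
      P@_(FMonom w) * \prod_(q <- zip w (behead w)) dot (alpha q.2) (e q.1).

(* A directed graph on the finite vertex set T is given by its set of edges;
   the edge d goes from d.1 to d.2. *)
Definition component (T : finType) (G : {set T * T}) (x : T) : {set T} :=
  [set y | connect [rel u v | ((u, v) \in G) || ((v, u) \in G)] x y].

Definition component_edges (T : finType) (G : {set T * T}) (x : T) :
    {set T * T} :=
  [set d in G | (d.1 \in component G x) && (d.2 \in component G x)].

Definition chain_edges (T : finType) (p : seq T) : {set T * T} :=
  [set d | d \in zip p (behead p)].

Definition cycle_edges (T : finType) (p : seq T) : {set T * T} :=
  [set d | d \in zip p (rot 1 p)].

Definition doomb (T : finType) (G : {set T * T}) : bool :=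
  [forall x : T, [exists p : #|component G x|.-tuple T,
    [&& uniq p, [set y in p] == component G x
      & (component_edges G x == chain_edges p)
        || (component_edges G x == cycle_edges p)]]].

Definition doombs (N k : nat) : {set {set 'I_N * 'I_N}} :=
  [set G | doomb G & #|G| == k].

Definition graph_weight (R : realType) (V : vectType R)
    (dot : {dot V for idfun}) (N d : nat) (e alpha : 'I_N -> V)
    (P : {malg R[{fmonom 'I_N}]}) (G : {set 'I_N * 'I_N}) : R :=
  \prod_(g in G) edge_weight dot d e alpha P g.1 g.2.

(* The edges are enumerated in the same way for rows and columns, so the
   determinant does not depend on the enumeration. *)
Definition edge_matrix (R : realType) (V : vectType R)
    (dot : {dot V for idfun}) (N : nat) (e alpha : 'I_N -> V)
    (G : {set 'I_N * 'I_N}) : 'M[R]_#|G| :=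
  \matrix_(i < #|G|, j < #|G|) dot (alpha (enum_val i).1) (e (enum_val j).2).

Definition mu (R : realType) (V : vectType R) (dot : {dot V for idfun})
    (N d : nat) (e alpha : 'I_N -> V) (P : {malg R[{fmonom 'I_N}]})
    (k : nat) : R :=
  \sum_(G in doombs N k)
    graph_weight dot d e alpha P G * \det (edge_matrix dot e alpha G).

(* Main.v *)
Require Import Defs.
From mathcomp Require Import all_boot all_order all_algebra.
From mathcomp Require Import sesquilinear reals finmap monalg.
From mathcomp Require Import perm.

Set Implicit Arguments.
Unset Strict Implicit.
Unset Printing Implicit Defensive.

Import GRing.Theory.

Local Open Scope ring_scope.

(** Grouping the words of P by their first letter a and last letter b turns M
    into a sum of N^2 rank-one operators, one for each possible edge:
      M v = \sum_(a, b) W_P(a, b) <alpha_a, v> e_b    ([nc_eval_rank1]).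

    For any finite family of columns u_d and rows v_d, the characteristic
    polynomial of \sum_d u_d v_d has as its k-th coefficient, up to the sign
    (-1)^k, the sum over the k-element sets S of indices of the Gram-like
    determinants det (v_d1 u_d2), d1, d2 in S ([char_poly_sum_rank1]).  Indeed
    the sum is a product X Y with the columns u_d in X and the rows v_d in Y;
    X Y and Y X have the same characteristic polynomial up to a power of 'X,
    and the coefficients for Y X are sums of principal minors.

    Applied to M, this gives a sum over all directed graphs G, that is, over
    all sets of edges, and the minor attached to G is
    W_P(G) det <alpha_{d1^-}, e_{d2^+}>.  If two edges of G share their initial
    vertex, this determinant has two equal rows; if they share their terminal
    vertex, two equal columns.  So only partial injections contribute, and
    each of them is a disjoint union of chains and cycles
    ([partial_injection_doomb]). *)

(** * Characteristic polynomials of sums of rank-one matrices *)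

(** Rows and columns are permuted together, so the two signs cancel. *)
Lemma det_mxsub_inj (A : comNzRingType) (m : nat) (B : 'M[A]_m)
    (s : 'I_m -> 'I_m) : injective s -> \det (mxsub s s B) = \det B.
Proof.
move=> sI; have -> : mxsub s s B = row_perm (perm sI) (col_perm (perm sI) B).
  by apply/matrixP=> i j; rewrite !mxE !permE.
rewrite row_permE col_permE !det_mulmx !det_perm mulrCA.
by rewrite -signr_addb odd_permV addbb mulr1.
Qed.

(** A principal minor depends on the set of its indices only, not on the order
    in which they are listed; this allows passing between the enumerations of a
    set, of its image under a bijection and of an ordinal type. *)
Lemma det_reindex (A : comNzRingType) (T : finType) (b : T -> T -> A)
    (k l : nat) (f : 'I_k -> T) (g : 'I_l -> T) :
    injective f -> injective g -> codom f =i codom g ->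
  \det (\matrix_(i, j) b (f i) (f j)) = \det (\matrix_(i, j) b (g i) (g j)).
Proof.
move=> fI gI fg; have kl : k = l.
  by rewrite -[k]card_ord -(card_codom fI) (eq_card fg) card_codom ?card_ord.
case: l / kl g gI fg => g gI fg.
have f_in i : f i \in codom g by rewrite -fg codom_f.
pose s i := iinv (f_in i).
have gs i : g (s i) = f i by rewrite f_iinv.
have sI : injective s by move=> i j /(congr1 g); rewrite !gs => /fI.
rewrite -[RHS](det_mxsub_inj _ sI); congr (\det _).
by apply/matrixP=> i j; rewrite !mxE !gs.
Qed.

(** Listing the indices in S first makes the matrix block upper triangular,
    with the principal submatrix on S and a scalar block on the diagonal. *)
Lemma det_rows_scalar (A : comNzRingType) (m : nat) (B : 'M[A]_m) (t : A)
    (S : {set 'I_m}) :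
  \det (\matrix_(i, j) if i \in S then B i j else t *+ (i == j)) =
    t ^+ (m - #|S|) *
    \det (\matrix_(i < #|S|, j < #|S|) B (enum_val i) (enum_val j)).
Proof.
set k := #|S|; set l := #|~: S|.
pose f (i : 'I_(k + l)) : 'I_m :=
  match split i with inl i => enum_val i | inr i => enum_val i end.
have fl i : f (lshift l i) = enum_val i by rewrite /f (unsplitK (inl i)).
have fr i : f (rshift k i) = enum_val i by rewrite /f (unsplitK (inr i)).
have inS (i : 'I_k) : enum_val i \in S by exact: enum_valP.
have notinS (i : 'I_l) : enum_val i \in S = false.
  by have := enum_valP i; rewrite inE => /negbTE.
have disj (i : 'I_k) (j : 'I_l) : (enum_val i : 'I_m) != enum_val j.
  by apply: contraFneq (notinS j) => <-.
have fI : injective f.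
  move=> i j; case: (split_ordP i) => {}i ->; case: (split_ordP j) => {}j ->.
  - by rewrite !fl => /enum_val_inj->.
  - by rewrite fl fr => /eqP; rewrite (negbTE (disj _ _)).
  - by rewrite fl fr => /esym/eqP; rewrite (negbTE (disj _ _)).
  - by rewrite !fr => /enum_val_inj->.
have klm : (k + l)%N = m by rewrite cardsC card_ord.
have f_onto : codom f =i codom (@id 'I_m).
  move=> x; rewrite (inj_card_onto fI) ?card_ord ?klm //.
  by apply/esym/codomP; exists x.
set C := \matrix_(i, j) _.
have -> : \det C = \det (\matrix_(i, j) C (f i) (f j)).
  rewrite (det_reindex _ fI _ f_onto) //; congr (\det _).
  by apply/matrixP=> i j; rewrite [RHS]mxE.
set D := \matrix_(i < k, j < k) _.
have -> : \matrix_(i, j) C (f i) (f j) =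
    block_mx D (\matrix_(i, j) B (enum_val i) (enum_val j)) 0 t%:M.
  apply/matrixP=> i j; rewrite [LHS]mxE mxE.
  case: (split_ordP i) => {}i ->; case: (split_ordP j) => {}j ->;
    rewrite ?(block_mxEul, block_mxEur, block_mxEdl, block_mxEdr) ?(fl, fr)
            !mxE ?inS ?notinS //.
  - by rewrite eq_sym (negbTE (disj _ _)).
  - by rewrite (inj_eq enum_val_inj).
by rewrite det_ublock det_scalar mulrC -klm addKn.
Qed.

(** Each row is the sum of a row of t%:M and a row of B; multilinearity expands
    the determinant over the set S of rows taken from B. *)
Lemma det_scalar_add (A : comNzRingType) (m : nat) (B : 'M[A]_m) (t : A) :
  \det (t%:M + B) = \sum_(S : {set 'I_m}) t ^+ (m - #|S|) *
    \det (\matrix_(i < #|S|, j < #|S|) B (enum_val i) (enum_val j)).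
Proof.
under [RHS]eq_bigr => S _ do rewrite -det_rows_scalar /determinant.
rewrite exchange_big /=; apply: eq_bigr => s _; rewrite -mulr_sumr.
congr (_ * _); under eq_bigr => i _ do rewrite !mxE addrC.
rewrite bigA_distr; apply: eq_bigr => S _.
by apply: eq_bigr => i _; rewrite !mxE.
Qed.

(** With t = 'X, both sides are 'X^m times the determinant of the block matrix
    with rows (t, X) and (Y, 1), computed by clearing Y in two ways: a column
    operation leaves t - X Y, and a row operation, which also multiplies the
    lower rows by t, leaves t - Y X. *)
Lemma char_poly_mulmxC (A : comNzRingType) (n m : nat) (X : 'M[A]_(n, m))
    (Y : 'M[A]_(m, n)) :
  'X^m * char_poly (X *m Y) = 'X^n * char_poly (Y *m X).
Proof.
rewrite /char_poly /char_poly_mx !map_mxM /=.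
set x := map_mx polyC X; set y := map_mx polyC Y; set t := 'X.
pose K := block_mx t%:M x y 1%:M.
have KL : K *m block_mx 1%:M 0 (- y) 1%:M = block_mx (t%:M - x *m y) x 0 1%:M.
  rewrite mulmx_block !mulmx1 !mulmx0 !mul1mx !add0r.
  by rewrite mulmxN subrr.
have LK : block_mx 1%:M 0 (- y) t%:M *m K = block_mx t%:M x 0 (t%:M - y *m x).
  rewrite mulmx_block !mul1mx !mul0mx !mulmx1 !addr0.
  by rewrite mulNmx scalar_mxC addNr addrC mulNmx.
have dK : \det K = \det (t%:M - x *m y).
  have := congr1 determinant KL.
  by rewrite det_mulmx det_lblock det_ublock !det1 !mulr1.
have := congr1 determinant LK.
by rewrite det_mulmx det_lblock det_ublock det1 mul1r !det_scalar dK.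
Qed.

Lemma det_mulmx_tall (F : fieldType) (k n : nat) (Y : 'M[F]_(k, n))
    (X : 'M[F]_(n, k)) : (n < k)%N -> \det (Y *m X) = 0.
Proof.
move=> nk; apply/eqP; apply: contraTT nk => YX.
have /mxrank_unit rk : Y *m X \in unitmx by rewrite unitmxE unitfE.
by rewrite -leqNgt -rk mulmx_max_rank.
Qed.

(** The expansion is read off from the product of the rows v by the columns u,
    a matrix of size #|T|, which may be larger or smaller than n; multiplying
    by 'X^#|T| puts both sizes on the same footing.  The sum stops at k = n
    because larger minors factor through a space of dimension n. *)
Lemma char_poly_sum_rank1 (F : fieldType) (T : finType) (n : nat)
    (u : T -> 'cV[F]_n) (v : T -> 'rV[F]_n) :
  char_poly (\sum_d u d *m v d) = \sum_(0 <= k < n.+1)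
    ((-1) ^+ k * \sum_(S : {set T} | #|S| == k)
       \det (\matrix_(i < #|S|, j < #|S|)
               (v (enum_val i) *m u (enum_val j)) 0 0)) *: 'X^(n - k).
Proof.
set m := #|T|.
pose X : 'M[F]_(n, m) := \matrix_(i, d) u (enum_val d) i 0.
pose Y : 'M[F]_(m, n) := \matrix_(d, j) v (enum_val d) 0 j.
have -> : \sum_d u d *m v d = X *m Y.
  apply/matrixP=> i j; rewrite summxE mxE.
  rewrite (reindex _ (onW_bij _ (@enum_val_bij T))) /=.
  by apply: eq_bigr => d _; rewrite !mxE big_ord1.
pose D (S : {set T}) := \det (\matrix_(i < #|S|, j < #|S|)
               (v (enum_val i) *m u (enum_val j)) 0 0).
have D0 (S : {set T}) : (n < #|S|)%N -> D S = 0.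
  move=> nS; pose Y' : 'M[F]_(#|S|, n) := \matrix_(i, j) v (enum_val i) 0 j.
  pose X' : 'M[F]_(n, #|S|) := \matrix_(i, j) u (enum_val j) i 0.
  rewrite -(det_mulmx_tall Y' X' nS); congr (\det _).
  by apply/matrixP=> i j; rewrite !mxE; apply: eq_bigr => l _; rewrite !mxE.
have minor (S : {set 'I_m}) : \det (\matrix_(i < #|S|, j < #|S|)
     (- map_mx polyC (Y *m X)) (enum_val i) (enum_val j)) =
     ((-1) ^+ #|S| * D (enum_val @: S))%:P.
  pose g (d : 'I_#|enum_val @: S|) : 'I_m := enum_rank (enum_val d : T).
  have gI : injective g by move=> d d' /enum_rank_inj/enum_val_inj.
  rewrite (@det_reindex _ _
             (fun i j => (- map_mx polyC (Y *m X)) i j) _ _ _ g) //.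
  - rewrite -(card_imset S enum_val_inj) polyCM rmorphXn rmorphN1 /=.
    rewrite -det_map_mx -detZ; congr (\det _); apply/matrixP=> i j.
    rewrite !mxE mulN1r; congr (- _%:P); apply: eq_bigr => l _.
    by rewrite !mxE !enum_rankK.
  - exact: enum_val_inj.
  - move=> i; apply/codomP/codomP=> -[d ->].
      have dS : enum_val (enum_val d) \in enum_val @: S.
        by rewrite imset_f ?enum_valP.
      exists (enum_rank_in dS (enum_val (enum_val d))).
      by rewrite /g enum_rankK_in ?enum_valK.
    have /imsetP[i' i'S gd] := enum_valP d.
    by exists (enum_rank_in i'S i'); rewrite enum_rankK_in // /g gd enum_valK.
have key : 'X^m * char_poly (X *m Y) =
    'X^m * \sum_(S : {set T} | (#|S| <= n)%N)
             ((-1) ^+ #|S| * D S) *: 'X^(n - #|S|).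
  rewrite char_poly_mulmxC /char_poly /char_poly_mx det_scalar_add !mulr_sumr.
  rewrite [RHS]big_mkcond.
  have bij : bijective (fun S : {set 'I_m} => (@enum_val T T) @: S).
    exists (fun S : {set T} => (@enum_rank T) @: S) => S; rewrite -imset_comp.
      by rewrite -[RHS]imset_id; apply: eq_imset => i /=; rewrite enum_valK.
    by rewrite -[RHS]imset_id; apply: eq_imset => i /=; rewrite enum_rankK.
  rewrite [RHS](reindex (fun S : {set 'I_m} => (@enum_val T T) @: S)) /=;
    last by case: bij => g gK Kg; exists g => x _.
  apply: eq_bigr => S _.
  rewrite minor card_imset; last exact: enum_val_inj.
  have Sm : (#|S| <= m)%N by apply: leq_trans (max_card _) _; rewrite card_ord.
  case: leqP => Sn.
    rewrite -mul_polyC [LHS]mulrA [RHS]mulrCA -!exprD [RHS]mulrC.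
    by congr ('X^_ * _); rewrite addnBA // addnC addnBA.
  by rewrite D0 ?mulr0 ?polyC0 ?mulr0 // card_imset //; exact: enum_val_inj.
have Xm0 : 'X^m != 0 :> {poly F} by rewrite monic_neq0 ?monicXn.
rewrite (mulfI Xm0 key) big_mkord.
rewrite (partition_big (fun S : {set T} => inord #|S| : 'I_n.+1) xpredT) //=.
apply: eq_bigr => k _; rewrite mulr_sumr scaler_suml.
apply: eq_big => [S|S /andP[Sn]].
  apply/andP/eqP => [[Sn /eqP <-]|Sk]; first by rewrite inordK.
  by rewrite Sk -ltnS ltn_ord inord_val.
by move=> /eqP <-; rewrite inordK.
Qed.

(** * Partial injections are disjoint unions of chains and cycles *)

(** For a chain with first vertex z and remaining vertices s, its edges are the
    members of [zip (z :: s) s]; these lemmas say which vertices of the chain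
    have a successor or a predecessor along it. *)
Lemma zip_succ (T : eqType) (z : T) (s : seq T) (u : T) :
  u \in z :: s -> u != last z s -> exists v, (u, v) \in zip (z :: s) s.
Proof.
elim: s z => [|y s IHs] z /=; first by rewrite inE => ->.
rewrite inE => /predU1P[-> _|us ul]; first by exists y; rewrite mem_head.
by have [v uv] := IHs y us ul; exists v; rewrite inE uv orbT.
Qed.

Lemma zip_pred (T : eqType) (z : T) (s : seq T) (v : T) :
  v \in s -> exists u, (u, v) \in zip (z :: s) s.
Proof.
elim: s z => [|y s IHs] z //=; rewrite inE => /predU1P[->|vs].
  by exists z; rewrite mem_head.
by have [u uv] := IHs y vs; exists u; rewrite inE uv orbT.
Qed.

Lemma mem_zip_cons (T : eqType) (z : T) (s : seq T) (u v : T) :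
  (u, v) \in zip (z :: s) s -> (u \in belast z s) && (v \in s).
Proof.
elim: s z => [|y s IHs] z //=; rewrite !inE.
case/predU1P=> [[-> ->]|/IHs/andP[us vs]]; first by rewrite !eqxx.
by rewrite us vs !orbT.
Qed.

Lemma path_zip (T : eqType) (r : rel T) (z : T) (s : seq T) (q : T * T) :
  path r z s -> q \in zip (z :: s) s -> r q.1 q.2.
Proof.
elim: s z => [|y s IHs] z //= /andP[zy ys]; rewrite inE.
by case/predU1P=> [->//|]; apply: IHs.
Qed.

Lemma zip_rot1 (T : eqType) (z : T) (s : seq T) :
  zip (z :: s) (rot 1 (z :: s)) = rcons (zip (z :: s) s) (last z s, z).
Proof.
rewrite rot1_cons; move: {2 5}z => w.
by elim: s z => [|y s IHs] z //=; rewrite IHs.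
Qed.

(** A simple path through x of maximal length cannot be extended, so an edge
    leaving its end or entering its start must meet the path itself. *)
Lemma longest_path_through (T : finType) (r : rel T) (x : T) :
  exists z s, [/\ x \in z :: s, uniq (z :: s), path r z s,
    forall w, r (last z s) w -> w \in z :: s &
    forall w, r w z -> w \in z :: s].
Proof.
pose ok m := [exists p : m.-tuple T, [&& x \in val p, uniq p & sorted r p]].
have ok_ex : exists m, ok m.
  by exists 1%N; apply/existsP; exists [tuple x]; rewrite /= mem_head.
have ok_max m : ok m -> (m <= #|T|)%N.
  by case/existsP=> p /and3P[_ pU _]; rewrite -(size_tuple p)
    -(card_uniqP pU) max_card.
case: (ex_maxnP ok_ex ok_max) => m /existsP[p /and3P[xp pU rp]] maxm.
have maxp q : x \in q -> uniq q -> sorted r q -> (size q <= m)%N.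
  move=> xq qU rq; apply: maxm; apply/existsP; exists (in_tuple q).
  by rewrite /= xq qU rq.
case: p xp pU rp => [[|z s] /= /eqP szp] xp pU rp.
  by rewrite in_nil in xp.
exists z, s; split=> // w rw; apply: contraT => wp.
  have : (size (rcons (z :: s) w) <= m)%N.
    apply: maxp; first by rewrite mem_rcons inE xp orbT.
      by rewrite rcons_uniq wp.
    by rewrite /= rcons_path rp.
  by rewrite size_rcons /= szp ltnn.
have : (size (w :: z :: s) <= m)%N.
  apply: maxp; first by rewrite inE xp orbT.
    by rewrite cons_uniq wp.
  by rewrite /= rw.
by rewrite /= szp ltnn.
Qed.

(** Take a simple path through x that cannot be extended, from z to y.  An edge
    at any vertex other than the ends must be the path edge there, because
    edges with a common initial (or terminal) vertex coincide.  An edge leaving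
    y leads back to the path, and not to a vertex with a predecessor on the
    path, since that predecessor would be y; so it leads to z.  Likewise the
    only possible edge entering z comes from y.  The component of x is thus the
    path, with the closing edge (y, z) or without it. *)
Lemma partial_injection_doomb (T : finType) (G : {set T * T}) :
    {in G &, injective (fun d => d.1)} -> {in G &, injective (fun d => d.2)} ->
  doomb G.
Proof.
move=> fst_inj snd_inj; apply/forallP=> x.
pose r := [rel u v | (u, v) \in G].
have [z [s [xp pU rp last_out z_in]]] := longest_path_through r x.
set p := z :: s in xp pU last_out z_in; set y := last z s in last_out.
have zipG q : q \in zip p s -> q \in G.
  by case: q => u v /(path_zip rp).
have y_last u : (y, u) \notin zip p s.
  apply/negP=> /mem_zip_cons/andP[ys _].
  by move: pU; rewrite /p lastI rcons_uniq ys.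
have z_first u : (u, z) \notin zip p s.
  by apply/negP=> /mem_zip_cons/andP[_ zs]; move: pU; rewrite /= zs.
have yp : y \in p by rewrite mem_last.
have succ u v : u \in p -> (u, v) \in G ->
    ((u, v) \in zip p s) || ((u, v) == (y, z)).
  move=> up uvG; have [uy|uy] := eqVneq u y; last first.
    have [w uw] := zip_succ up uy.
    by rewrite (fst_inj _ _ uvG (zipG _ uw) erefl) uw.
  rewrite {u up}uy in uvG *; have := last_out _ uvG; rewrite inE.
  case/predU1P=> [->|vs]; first by rewrite eqxx orbT.
  have [w wv] := zip_pred z vs; have := snd_inj _ _ (zipG _ wv) uvG erefl.
  by case=> wy; move: wv; rewrite wy (negbTE (y_last _)).
have pred u v : v \in p -> (u, v) \in G ->
    ((u, v) \in zip p s) || ((u, v) == (y, z)).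
  move=> vp uvG; move: vp; rewrite inE => /predU1P[vz|vs]; last first.
    have [w wv] := zip_pred z vs.
    by rewrite (snd_inj _ _ uvG (zipG _ wv) erefl) wv.
  rewrite {v}vz in uvG *; have up := z_in _ uvG.
  have [->|uy] := eqVneq u y; first by rewrite eqxx orbT.
  have [w uw] := zip_succ up uy; have := fst_inj _ _ (zipG _ uw) uvG erefl.
  by case=> wz; move: uw; rewrite wz (negbTE (z_first _)).
have zip_p u v : (u, v) \in zip p s -> (u \in p) && (v \in p).
  case/mem_zip_cons/andP=> us vs.
  by rewrite (mem_belast us) inE vs orbT.
pose c := [rel u v | ((u, v) \in G) || ((v, u) \in G)].
have cC : symmetric c by move=> u v; rewrite /= orbC.
have conn_z u : u \in p -> connect c z u.
  move=> up; apply/connectP; have rc : subrel r c by move=> a b /= ->.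
  case/splitPl: up rp => s1 s2 <-; rewrite cat_path => /andP[rs1 _].
  by exists s1 => //; apply: sub_path rs1.
have compE : [set v in p] = component G x.
  apply/setP=> v; rewrite !inE; apply/idP/idP=> [vp|].
    apply: connect_trans (conn_z _ vp); rewrite (sym_connect_sym cC).
    exact: conn_z.
  case/connectP=> q; elim: q x xp => [|w q IHq] u up /=; first by move=> _ ->.
  case/andP=> uw; apply: IHq; case/orP: uw => [/(succ _ _ up)|/(pred _ _ up)].
    by case/orP=> [/zip_p/andP[]//|/eqP[_ ->]]; rewrite mem_head.
  by case/orP=> [/zip_p/andP[]//|/eqP[-> _]].
have edgesE : component_edges G x =
    [set q in zip p s] :|: [set q in [:: (y, z)] | q \in G].
  rewrite /component_edges -compE; apply/setP=> -[u v].
  rewrite in_setU !in_set mem_seq1 /=.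
  apply/andP/orP=> [[uvG /andP[up _]]|].
    by case/orP: (succ _ _ up uvG) => -> //; [left|right; rewrite uvG].
  case=> [uv|/andP[/eqP[-> ->] ->]]; last by rewrite yp mem_head.
  by rewrite zipG // zip_p.
have szp : size p == #|component G x|.
  by rewrite -compE cardsE; apply/eqP/esym/card_uniqP.
apply/existsP; exists (Tuple szp); apply/and3P.
split; [exact: pU | exact/eqP | ].
rewrite edgesE -[val (Tuple szp)]/p /cycle_edges zip_rot1 /chain_edges /=.
have [yzG|yzG] := boolP ((y, z) \in G).
  apply/orP; right; apply/eqP/setP=> q.
  rewrite !inE mem_rcons inE orbC; congr (_ || _).
  by case: eqP => // ->.
apply/orP; left; apply/eqP/setP=> q; rewrite !inE.
by case: eqP => [->|//]; rewrite ?(negbTE yzG) ?orbF.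
Qed.

(** * Reduction of the operator to rank-one terms indexed by edges *)

(** The word operator is a left fold, so the induction needs an arbitrary
    operator f already applied before the first letter. *)
Lemma foldl_rank1_op (R : realType) (V : vectType R) (dot : {dot V for idfun})
    (N : nat) (e alpha : 'I_N -> V) (f : 'End(V)) (i : 'I_N) (w : seq 'I_N)
    (v : V) :
  let M j := rank1_op dot (alpha j) (e j) in
  foldl (fun g j => (M j \o g)%VF) (M i \o f)%VF w v =
    (dot (alpha i) (f v)
       * \prod_(q <- zip (i :: w) w) dot (alpha q.2) (e q.1)) *: e (last i w).
Proof.
move=> M; elim: w i f => [|j w IHw] i f /=.
  by rewrite big_nil mulr1 comp_lfunE rank1_opE.
rewrite IHw comp_lfunE rank1_opE linearZr /= big_cons /= mulrA.
by rewrite -!scalerA.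
Qed.

Lemma word_op_rank1 (R : realType) (V : vectType R) (dot : {dot V for idfun})
    (N : nat) (e alpha : 'I_N -> V) (i : 'I_N) (w : seq 'I_N) (v : V) :
  word_op (fun j => rank1_op dot (alpha j) (e j)) (i :: w) v =
    (dot (alpha i) v
       * \prod_(q <- zip (i :: w) w) dot (alpha q.2) (e q.1)) *: e (last i w).
Proof. by rewrite /word_op /= foldl_rank1_op id_lfunE. Qed.

(** The evaluation of P sums over its support, the edge weights sum over all
    words length by length; the two agree since the words outside the support
    contribute nothing. *)
Lemma sum_msupp_by_length (R : nzRingType) (V : nmodType) (I : finType)
    (P : {malg R[{fmonom I}]}) (d : nat) (Phi : seq I -> V) :
    (forall m : {fmonom I}, m \in msupp P -> (fdeg m <= d)%N) ->
    (forall w, P@_(FMonom w) = 0 -> Phi w = 0) ->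
  \sum_(m <- msupp P) Phi (fmonom_val m) =
    \sum_(0 <= s < d.+1) \sum_(w : s.-tuple I) Phi w.
Proof.
move=> deg Phi0.
have by_length s : \sum_(w : s.-tuple I) Phi w =
    \sum_(m <- msupp P | fdeg m == s) Phi (fmonom_val m).
  rewrite (bigID (fun w : s.-tuple I => FMonom w \in msupp P)) /= addrC big1.
    rewrite add0r -big_filter -[RHS]big_filter.
    rewrite -(big_map (fun w : s.-tuple I => FMonom w) xpredT
                (fun m => Phi (fmonom_val m))).
    apply: perm_big; apply: uniq_perm.
    - rewrite map_inj_uniq ?filter_uniq ?index_enum_uniq //.
      by move=> w w' [] /val_inj.
    - by rewrite filter_uniq ?fset_uniq.
    move=> m; apply/mapP/idP => [[w]|].
      rewrite mem_filter => /andP[wP _] ->.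
      by rewrite mem_filter fdegE /= size_tuple eqxx.
    case: m => w; rewrite mem_filter fdegE /= => /andP[ws wP].
    by exists (Tuple ws) => //; rewrite mem_filter mem_index_enum wP.
  by move=> w wP; apply: Phi0; exact: mcoeff_outdom.
rewrite big_mkord; under [RHS]eq_bigr => s _ do rewrite by_length.
rewrite [RHS](exchange_big_dep xpredT) //= big_seq [RHS]big_seq.
apply: eq_bigr => m mP; have md : (fdeg m < d.+1)%N by rewrite ltnS deg.
by rewrite (big_pred1 (Ordinal md)) // => s; rewrite eq_sym -val_eqE.
Qed.

(** A word contributes to exactly one edge: from its first letter, which reads
    the argument v through alpha, to its last letter, which gives the output
    direction e. *)
Lemma nc_eval_rank1 (R : realType) (V : vectType R) (dot : {dot V for idfun})
    (N d : nat) (e alpha : 'I_N -> V) (P : {malg R[{fmonom 'I_N}]})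
    (P_const : P@_(FMonom [::]) = 0)
    (P_deg : forall m : {fmonom 'I_N}, m \in msupp P -> (fdeg m <= d)%N)
    (v : V) :
  nc_eval P (fun i => rank1_op dot (alpha i) (e i)) v =
    \sum_(g : 'I_N * 'I_N)
      (edge_weight dot d e alpha P g.1 g.2 * dot (alpha g.1) v) *: e g.2.
Proof.
set M := fun i => _; pose Phi w := P@_(FMonom w) *: word_op M w v.
have -> : nc_eval P M v = \sum_(m <- msupp P) Phi (fmonom_val m).
  rewrite /nc_eval sum_lfunE; apply: eq_bigr => -[w] _.
  by rewrite scale_lfunE.
rewrite (sum_msupp_by_length P_deg) => [|w]; last first.
  by rewrite /Phi => ->; rewrite scale0r.
rewrite big_nat_recl // big1 ?add0r => [|w _]; last first.
  by rewrite (tuple0 w) /Phi P_const scale0r.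
rewrite /edge_weight; under [RHS]eq_bigr => g _.
  rewrite big_add1 /= mulr_suml scaler_suml.
  under eq_bigr => s _ do rewrite mulr_suml scaler_suml big_mkcond /=.
  over.
rewrite exchange_big /=; apply: eq_bigr => s _.
rewrite exchange_big /=; apply: eq_bigr => -[[//|i w] szw] _ /=.
rewrite -big_mkcond /= (big_pred1 (i, last i w)) => [|[a b]]; last first.
  rewrite -[RHS]/((a == i) && (b == last i w)).
  by rewrite !(eq_sym i) (eq_sym (last _ _)).
by rewrite /Phi word_op_rank1 scalerA -mulrA (mulrC (dot _ _)).
Qed.

(** Edges with a common initial vertex give equal rows, edges with a common
    terminal vertex equal columns; a nonzero minor excludes both. *)
Lemma edge_minor_doomb (R : realType) (V : vectType R)
    (dot : {dot V for idfun}) (N : nat) (e alpha : 'I_N -> V)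
    (G : {set 'I_N * 'I_N}) :
  \det (edge_matrix dot e alpha G) != 0 -> doomb G.
Proof.
move=> detG; apply: partial_injection_doomb => g h gG hG gh.
  apply: contraNeq detG => neq_gh; apply/eqP.
  apply: (@determinant_alternate _ _ _ (enum_rank_in gG g) (enum_rank_in gG h)).
    apply: contraNneq neq_gh => /(congr1 enum_val).
    by rewrite !enum_rankK_in // => ->.
  by move=> j; rewrite !mxE !enum_rankK_in // gh.
apply: contraNeq detG => neq_gh; rewrite -det_tr; apply/eqP.
apply: (@determinant_alternate _ _ _ (enum_rank_in gG g) (enum_rank_in gG h)).
  apply: contraNneq neq_gh => /(congr1 enum_val).
    by rewrite !enum_rankK_in // => ->.
by move=> j; rewrite !mxE !enum_rankK_in // gh.
Qed.

Theorem theorem1 (R : realType) (V : vectType R) (n : nat)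
    (dimV : \dim {:V} = n) (dot : {dot V for idfun})
    (N : nat) (N_ge1 : (1 <= N)%N) (e alpha : 'I_N -> V)
    (d : nat) (P : {malg R[{fmonom 'I_N}]})
    (P_const : P@_(FMonom [::]) = 0)
    (P_deg : forall m : {fmonom 'I_N}, m \in msupp P -> (fdeg m <= d)%N) :
  let M := nc_eval P (fun i => rank1_op dot (alpha i) (e i)) in
  char_lfun M =
    \sum_(0 <= k < n.+1) ((-1) ^+ k * mu dot d e alpha P k) *: 'X^(n - k).
Proof.
move=> M; subst n; rewrite /char_lfun; set b := vbasis {:V}.
pose W (g : 'I_N * 'I_N) := edge_weight dot d e alpha P g.1 g.2.
pose u g : 'cV[R]_(\dim {:V}) := \col_i (W g * dot (alpha g.1) b`_i).
pose v (g : 'I_N * 'I_N) : 'rV[R]_(\dim {:V}) := \row_j coord b j (e g.2).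
have -> : passmx.mxof b b M = \sum_g u g *m v g.
  apply/matrixP=> i j; rewrite summxE !mxE /= passmx.vecof_delta.
  rewrite (nc_eval_rank1 _ _ _ P_const P_deg) linear_sum; apply: eq_bigr => g _.
  by rewrite linearZ !mxE big_ord1 !mxE.
rewrite char_poly_sum_rank1; apply: eq_bigr => k _; congr (_ * _ *: _).
have minor (G : {set 'I_N * 'I_N}) :
    \det (\matrix_(i < #|G|, j < #|G|)
            (v (enum_val i) *m u (enum_val j)) 0 0) =
    graph_weight dot d e alpha P G * \det (edge_matrix dot e alpha G).
  have -> : graph_weight dot d e alpha P G =
      \det (diag_mx (\row_(i < #|G|) W (enum_val i))).
    rewrite det_diag /graph_weight big_enum_val.
    by apply: eq_bigr => i _; rewrite mxE.
  (* The entry at (g, h) is W h * <alpha_{h^-}, e_{g^+}>: the transpose of the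
     edge matrix with its columns scaled by the weights. *)
  rewrite -[X in _ * X]det_tr mulrC -det_mulmx mul_mx_diag; congr (\det _).
  apply/matrixP=> i j; rewrite !mxE.
  rewrite [in RHS](coord_vbasis (memvf (e (enum_val i).2))).
  rewrite linear_sumr mulr_suml.
  apply: eq_bigr => l _; rewrite !mxE linearZr /=.
  by rewrite mulrCA mulrC.
rewrite /mu (bigID (@doomb _)) /= addrC big1 ?add0r => [|G /andP[_ notG]].
  apply: eq_big => [G|G _]; last exact: minor.
  by rewrite inE andbC.
apply/eqP; rewrite minor mulf_eq0; apply/orP; right.
by apply: contraNT notG; exact: edge_minor_doomb.
Qed.
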